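(* Let $f(w)=\sum_{i=0}^n w^ia_i$ be a regular octonionic polynomial of degree $n>0$. The following statements hold. (1) If the coefficients $a_1,\ldots,a_n$ are real and $a_0$ is non-real, then $f$ has only isolated zeros. (2) If $a_2,\ldots,a_n$ are real and either $a_0$ or $a_1$ is non-real, then $f$ has no spherical zeros. In particular, in each of these cases, the set $V(f)$ contains exactly $n$ elements, counted with their multiplicities.
   Context: $\mathbb{O}$ is the real alternative division algebra of octonions (an octonion is non-real if it is not in $\mathbb{R}$), $\overline{x}$ is octonionic conjugation, $|x|$ the norm. A regular octonionic polynomial of degree $n$ is a function $f:\mathbb{O}\to\mathbb{O}$, $f(w)=\sum_{i=0}^n w^i a_i$ with $a_i\in\mathbb{O}$, $a_n\ne0$. For $f=\sum_i w^ia_i$, $g=\sum_j w^jb_j$, put $(f\ast g)(w)=\sum_k w^k\big(\sum_{i+j=k}a_ib_j\big)$, $\overline f(w)=\sum_i w^i\overline{a}_i$, and $N(f)=f\ast\overline f=\overline f\ast f$, which has real coefficients. For $\alpha\in\mathbb{O}$ put $\Delta_\alpha(w)=w^2-w(\alpha+\overline\alpha)+|\alpha|^2$, a real polynomial. $\mathbb{S}_\alpha=\{\mathrm{Re}(\alpha)+|\mathrm{Im}(\alpha)|\,I : I\in\mathbb{O},\ I^2=-1\}$ is the conjugacy class of $\alpha$. $V(f)$ is the zero set of $f$. A real $\alpha\in V(f)$ is a real zero of $f$. A non-real $\alpha$ with $\mathbb{S}_\alpha\subset V(f)$ is a spherical zero of $f$; a non-real $\alpha\in V(f)$ with $\mathbb{S}_\alpha\not\subset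 V(f)$ is an isolated zero of $f$. For $\alpha\in V(f)$, the multiplicity of $\alpha$ is the integer $s\ge 0$ such that $\Delta_\alpha^s\mid N(f)$ and $\Delta_\alpha^{s+1}\nmid N(f)$. *)

(* Defs.v *)
From HB Require Import structures.
From mathcomp Require Import all_boot all_order all_algebra.
From mathcomp Require Import all_classical all_reals.
From mathcomp Require Import zify ring lra.

Set Implicit Arguments.
Unset Strict Implicit.
Unset Printing Implicit Defensive.

Import Order.TTheory GRing.Theory Num.Theory.
Local Open Scope classical_set_scope.
Local Open Scope ring_scope.

(* Octonions: the Cayley-Dickson doubling, iterated three times from R.       *)

Definition cd_mul (A : zmodType) (mul : A -> A -> A) (conj : A -> A)
    (x y : A * A) : A * A :=
  (mul x.1 y.1 - mul (conj y.2) x.2, mul y.2 x.1 + mul x.2 (conj y.1)).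

Definition cd_conj (A : zmodType) (conj : A -> A) (x : A * A) : A * A :=
  (conj x.1, - x.2).

(* Only the additive structure of the product type is kept. MathComp's        *)
(* componentwise [*] on pairs is not the octonionic product, which is [**].   *)
Definition octonion (R : realType) : Type :=
  (((R * R) * (R * R)) * ((R * R) * (R * R)))%type.

HB.instance Definition _ (R : realType) := GRing.Zmodule.on (octonion R).

Section Octonion.
Variable R : realType.
Implicit Types (x y z : octonion R) (r : R).

Definition omul : octonion R -> octonion R -> octonion R :=
  cd_mul (cd_mul (cd_mul *%R id) (cd_conj id)) (cd_conj (cd_conj id)).

Definition oconj : octonion R -> octonion R :=
  cd_conj (cd_conj (cd_conj id)).

Definition oreal r : octonion R := (((r, 0), (0, 0)), ((0, 0), (0, 0))).

Definition oRe x : R := x.1.1.1.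
Definition oIm x : octonion R := x - oreal (oRe x).

(* x ** oconj x is real, see [omul_conjr] *)
Definition onorm x : R := Num.sqrt (oRe (omul x (oconj x))).

(* The powers of an octonion do not depend on the bracketing, since an        *)
(* alternative algebra is power-associative.                                  *)
Definition opow x (k : nat) : octonion R := iter k (omul x) (oreal 1).

Definition is_real x : Prop := exists r, x = oreal r.

End Octonion.

Notation "x ** y" := (omul x y) (at level 40, left associativity) : ring_scope.

Lemma octonion_eq (R : realType) (x y : octonion R) :
  x.1.1.1 = y.1.1.1 -> x.1.1.2 = y.1.1.2 ->
  x.1.2.1 = y.1.2.1 -> x.1.2.2 = y.1.2.2 ->
  x.2.1.1 = y.2.1.1 -> x.2.1.2 = y.2.1.2 ->
  x.2.2.1 = y.2.2.1 -> x.2.2.2 = y.2.2.2 -> x = y.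
Proof.
move: x y => [[[a b] [c d]] [[e f] [g h]]] [[[a' b'] [c' d']] [[e' f'] [g' h']]].
by move=> /= -> -> -> -> -> -> -> ->.
Qed.

Ltac octonion_ring :=
  repeat match goal with
  | x : octonion _ |- _ => move: x => [[[? ?] [? ?]] [[? ?] [? ?]]]
  end;
  apply: octonion_eq; rewrite /= /oRe /=; ring.

Section OctonionTheory.
Variable R : realType.
Implicit Types (x y z : octonion R) (r : R).

Lemma omul1 x : x ** oreal 1 = x.
Proof. octonion_ring. Qed.

Lemma mul1o x : oreal 1 ** x = x.
Proof. octonion_ring. Qed.

Lemma omulDl x y z : (x + y) ** z = x ** z + y ** z.
Proof. octonion_ring. Qed.

Lemma omulDr x y z : x ** (y + z) = x ** y + x ** z.
Proof. octonion_ring. Qed.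

Lemma oreal_mulC r x : oreal r ** x = x ** oreal r.
Proof. octonion_ring. Qed.

Lemma omul_altl x y : x ** (x ** y) = (x ** x) ** y.
Proof. octonion_ring. Qed.

Lemma omul_altr x y : (y ** x) ** x = y ** (x ** x).
Proof. octonion_ring. Qed.

Lemma oconjK : involutive (@oconj R).
Proof. by move=> x; octonion_ring. Qed.

Lemma oconjD x y : oconj (x + y) = oconj x + oconj y.
Proof. octonion_ring. Qed.

Lemma oconjM x y : oconj (x ** y) = oconj y ** oconj x.
Proof. octonion_ring. Qed.

Lemma oaddconj x : x + oconj x = oreal (2 * oRe x).
Proof. octonion_ring. Qed.

Lemma oRe_mul_conj_ge0 x : 0 <= oRe (x ** oconj x).
Proof.
case: x => [[[a b] [c d]] [[e f] [g h]]].
rewrite (_ : oRe _ = a ^+ 2 + b ^+ 2 + (c ^+ 2 + d ^+ 2)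
                     + (e ^+ 2 + f ^+ 2 + (g ^+ 2 + h ^+ 2))); last first.
  by rewrite /oRe /=; ring.
by rewrite !addr_ge0 ?sqr_ge0.
Qed.

Lemma onorm_sqr x : onorm x ^+ 2 = oRe (x ** oconj x).
Proof. by rewrite sqr_sqrtr // oRe_mul_conj_ge0. Qed.

Lemma omul_conjr x : x ** oconj x = oreal (onorm x ^+ 2).
Proof. rewrite onorm_sqr; octonion_ring. Qed.

Lemma onormM x y : onorm (x ** y) = onorm x * onorm y.
Proof.
rewrite /onorm -sqrtrM ?oRe_mul_conj_ge0 //; congr Num.sqrt.
by rewrite /oRe /=; ring.
Qed.

Lemma onorm_eq0 x : onorm x = 0 -> x = 0.
Proof.
move=> /(congr1 (fun r => r ^+ 2)); rewrite onorm_sqr expr2 mul0r.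
case: x => [[[a b] [c d]] [[e f] [g h]]]; rewrite /oRe /= => E.
have {}E : a ^+ 2 + b ^+ 2 + (c ^+ 2 + d ^+ 2)
                     + (e ^+ 2 + f ^+ 2 + (g ^+ 2 + h ^+ 2)) = 0.
  by apply: etrans E; ring.
move/eqP: E.
rewrite !paddr_eq0 ?addr_ge0 ?sqr_ge0 // !sqrf_eq0.
case/andP=> /andP[/andP[/eqP-> /eqP->] /andP[/eqP-> /eqP->]].
by case/andP=> /andP[/eqP-> /eqP->] /andP[/eqP-> /eqP->].
Qed.

Lemma oconj_real x : oconj x = x -> x = oreal (oRe x).
Proof.
move=> /(congr1 (+%R x)); rewrite oaddconj => E.
have aux r : r + r = 2 * r by ring.
have eq0 r : 0 = r + r -> r = 0 by move=> ?; lra.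
case: x E => [[[a b] [c d]] [[e f] [g h]]].
rewrite /oreal /oRe /= => -[_ /eq0-> /eq0-> /eq0-> /eq0-> /eq0-> /eq0-> /eq0->].
by [].
Qed.

End OctonionTheory.

(* The polynomial sum_i w^i a_i is encoded by its coefficients                *)
(* [:: a_0; ...; a_n], of size n + 1; trailing zeros are not excluded.        *)
Definition octpoly (R : realType) : Type := seq (octonion R).

Section OctPoly.
Variable R : realType.
Implicit Types (f g : octpoly R) (w alpha : octonion R).

Definition oeval f w : octonion R := \sum_(i < size f) opow w i ** f`_i.

Definition star f g : octpoly R :=
  mkseq (fun k => \sum_(i < size f) \sum_(j < size g | (i + j == k)%N)
                    f`_i ** g`_j)
        (size f + size g).-1.

Definition conjp f : octpoly R := map (@oconj R) f.

Definition Nstar f : octpoly R := star f (conjp f).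

(* [Nstar f] as a real polynomial; nothing is lost by taking real parts, see  *)
(* [Nstar_real].                                                              *)
Definition normpoly f : {poly R} := \poly_(k < size (Nstar f)) oRe (Nstar f)`_k.

Definition Delta alpha : {poly R} :=
  'X^2 - (2 * oRe alpha) *: 'X + (onorm alpha ^+ 2)%:P.

Definition sphere alpha : set (octonion R) :=
  [set x | exists I, I ** I = - oreal 1 /\
     x = oreal (oRe alpha) + oreal (onorm (oIm alpha)) ** I].

Definition V f : set (octonion R) := [set w | oeval f w = 0].

Definition spherical_zero f alpha : Prop :=
  ~ is_real alpha /\ sphere alpha `<=` V f.

Definition isolated_zero f alpha : Prop :=
  [/\ ~ is_real alpha, V f alpha & ~ (sphere alpha `<=` V f)].

(* Exists and is unique as soon as [normpoly f != 0], see [multiplicityP] and *)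
(* [multiplicity_uniq].                                                       *)
Definition multiplicity f alpha : nat :=
  xget 0%N [set s : nat | Delta alpha ^+ s %| normpoly f /\
                          ~~ (Delta alpha ^+ s.+1 %| normpoly f)].

Definition has_exactly_zeros_with_mult f (n : nat) : Prop :=
  finite_set (V f) /\ (\sum_(alpha \in V f) multiplicity f alpha)%R = n.

End OctPoly.

Section OctPolyTheory.
Variable R : realType.
Implicit Types (f g : octpoly R) (w alpha : octonion R).

Lemma size_Nstar f : size (Nstar f) = (size f + size f).-1.
Proof. by rewrite size_mkseq size_map. Qed.

Lemma oconj_sum (I : Type) (r : seq I) (P : pred I) (F : I -> octonion R) :
  oconj (\sum_(i <- r | P i) F i) = \sum_(i <- r | P i) oconj (F i).
Proof.
apply: (big_morph (@oconj R)); first exact: oconjD.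
by apply: octonion_eq => /=; rewrite ?oppr0.
Qed.

Lemma nth_Nstar f k : (k < size (Nstar f))%N ->
  (Nstar f)`_k = \sum_(i < size f) \sum_(j < size f | (i + j == k)%N)
                    f`_i ** oconj f`_j.
Proof.
move=> kf; rewrite nth_mkseq -1?(size_mkseq (fun _ => 0)) ?size_mkseq; last first.
  by rewrite size_map -size_Nstar.
apply: eq_bigr => i _; rewrite size_map; apply: eq_bigr => j _.
by rewrite (nth_map 0).
Qed.

Lemma Nstar_real f k : (Nstar f)`_k = oreal (normpoly f)`_k.
Proof.
rewrite coef_poly; case: ifPn => [kf|]; last by rewrite -leqNgt => kf; rewrite nth_default.
apply: oconj_real; rewrite nth_Nstar // oconj_sum.
under eq_bigr do rewrite oconj_sum.
rewrite (exchange_big_dep xpredT) //=; apply: eq_bigr => i _.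
rewrite (eq_bigl (fun j : 'I__ => (i + j == k)%N)) => [|j].
  by apply: eq_bigr => j _; rewrite oconjM oconjK.
by rewrite addnC.
Qed.

Lemma Nstar_comm f : star (conjp f) f = Nstar f.
Proof.
apply: (@eq_from_nth _ 0); rewrite !size_mkseq size_map // => k kf.
rewrite nth_Nstar ?size_Nstar // nth_mkseq ?size_map //.
have comm x y : x ** oconj y + y ** oconj x
             = oconj y ** x + oconj x ** y :> octonion R.
  by octonion_ring.
set S := RHS; set T := LHS.
have TE : T = \sum_(i < size f) \sum_(j < size f | (i + j == k)%N)
                 oconj f`_i ** f`_j.
  rewrite /T; apply: eq_bigr => i _; apply: eq_bigr => j _.
  by rewrite (nth_map 0).
have swap (F : nat -> nat -> octonion R) :
    \sum_(i < size f) \sum_(j < size f | (i + j == k)%N) F i j =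
    \sum_(i < size f) \sum_(j < size f | (i + j == k)%N) F j i.
  rewrite (exchange_big_dep xpredT) //=; apply: eq_bigr => i _.
  by apply: eq_bigl => j; rewrite addnC.
have : S + S = T + T.
  have SE := swap (fun i j => f`_i ** oconj f`_j); rewrite -/S in SE.
  rewrite TE {2}(swap (fun i j => oconj f`_i ** f`_j)) {2}SE /S -!big_split /=.
  apply: eq_bigr => i _; rewrite -!big_split /=; apply: eq_bigr => j _.
  by rewrite comm addrC.
have half (r s : R) : r + r = s + s -> r = s by move=> ?; lra.
move: S T {TE} => [[[a b] [c d]] [[e g] [h i]]] [[[a' b'] [c' d']] [[e' g'] [h' i']]].
by move=> -[/half-> /half-> /half-> /half-> /half-> /half-> /half-> /half->].
Qed.

Lemma normpoly_neq0 f n : size f = n.+1 -> f`_n != 0 -> normpoly f != 0.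
Proof.
move=> fn; apply: contra_neq => Nf0.
have := Nstar_real f (n + n); rewrite Nf0 coef0 nth_Nstar; last first.
  by rewrite size_Nstar fn addSn addnS.
rewrite fn (bigD1 ord_max) //= [X in _ + X]big1 ?addr0 => [|i inn]; last first.
  apply: big1 => j /eqP ij; case/eqP: inn; apply: val_inj => /=.
  have := ltn_ord i; have := ltn_ord j; rewrite !ltnS => jn.
  rewrite leq_eqVlt => /orP[/eqP //|lin].
  by have := leq_add lin jn; rewrite addSn ij ltnn.
rewrite (big_pred1 ord_max) => [|j]; last by rewrite eqn_add2l.
by rewrite omul_conjr => -[/eqP]; rewrite sqrf_eq0 => /eqP/onorm_eq0.
Qed.

Lemma size_Delta alpha : size (Delta alpha) = 3%N.
Proof.
rewrite /Delta -addrA size_polyDl size_polyXn //.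
rewrite (leq_ltn_trans (size_polyD _ _)) // gtn_max size_polyN.
rewrite (leq_ltn_trans (size_scale_leq _ _)) ?size_polyX //=.
by rewrite (leq_ltn_trans (size_polyC_leq1 _)).
Qed.

Lemma multiplicityP f alpha : normpoly f != 0 ->
  (Delta alpha ^+ multiplicity f alpha %| normpoly f) /\
  ~~ (Delta alpha ^+ (multiplicity f alpha).+1 %| normpoly f).
Proof.
move=> Nf0; rewrite /multiplicity; set P := [set s | _].
suff : exists s, P s by move=> /(xgetPex 0%N).
have [s nds] : exists s, ~~ (Delta alpha ^+ s %| normpoly f).
  exists (size (normpoly f)); apply/negP => /(dvdp_leq Nf0).
  have := size_exp (Delta alpha) (size (normpoly f)).
  move: Nf0; rewrite -size_poly_gt0 size_Delta.
  set m := size (normpoly f); set k := size _.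
  clearbody m k; rewrite /=; lia.
elim: s nds => [|s IH]; first by rewrite expr0 dvd1p.
have [ds nds|nds _] := boolP (Delta alpha ^+ s %| normpoly f); last exact: IH.
by exists s.
Qed.

Lemma multiplicity_uniq f alpha s :
  Delta alpha ^+ s %| normpoly f -> ~~ (Delta alpha ^+ s.+1 %| normpoly f) ->
  multiplicity f alpha = s.
Proof.
move=> ds nds; have Nf0 : normpoly f != 0.
  by apply: contraNneq nds => ->; rewrite dvdp0.
have [dt ndt] := multiplicityP alpha Nf0; apply/eqP; rewrite eqn_leq.
apply/andP; split; rewrite leqNgt; apply/negP => lt.
  by case/negP: nds; apply: dvdp_trans dt; apply: dvdp_exp2l.
by case/negP: ndt; apply: dvdp_trans ds; apply: dvdp_exp2l.
Qed.

End OctPolyTheory.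

(* Main.v *)
(* Let p = (Re w, |Im w|) label the class of w, with quadratic D_p =          *)
(* (X - Re w)^2 + |Im w|^2. If X^k = A_k + B_k X modulo D_p, then also        *)
(* w^k = A_k + w B_k on the class, so f(w) = c + w d there with               *)
(* c = sum_i A_i a_i and d = sum_i B_i a_i depending only on the class, while *)
(* N(f) = |c|^2 + 2<c,d> X + |d|^2 X^2 modulo D_p. Hence D_p | N(f) iff       *)
(* c + w d = 0 has a root w in the class, and two such roots force c = d = 0, *)
(* i.e. a spherical zero. Since N(f) is nonnegative on R and of degree 2n, it *)
(* is a constant times a product of n quadratics D_p; without spherical zeros *)
(* each distinct p carries exactly one zero, whose multiplicity is the number *)
(* of occurrences of D_p. As A_0 = B_1 = 1 and A_1 = B_0 = 0, when            *)
(* a_2, ..., a_n are real, c = d = 0 forces a_0 and a_1 to be real.           *)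

Require Import Defs.
From mathcomp Require Import all_boot all_order all_algebra.
From mathcomp Require Import all_classical all_reals.
From mathcomp Require Import complex polyrcf.
From mathcomp Require Import ring lra zify.

Set Implicit Arguments.
Unset Strict Implicit.
Unset Printing Implicit Defensive.

Import Order.TTheory GRing.Theory Num.Theory.
Local Open Scope classical_set_scope.
Local Open Scope ring_scope.

(** The zeros of f are counted through the real quadratic factors of N(f). On a single class f is
    the affine map w -> c + w d ([oeval_class]), and the octonions have no zero divisors, so a class
    with two zeros has c = d = 0 and consists of zeros ([two_zeros_spherical]). The class of p
    contains a zero exactly when [quad p] divides N(f) ([zero_quad_dvd], [quad_dvd_zero]). At a real
    point N(f) equals |f|^2, so N(f) is a positive constant times n such quadratics
    ([nonneg_factor]), pairwise coprime for different classes. Without spherical zeros, classes of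
    factors and zeros therefore correspond one to one, and the multiplicities add up to n
    ([no_spherical_zeros_count]).

    The hypotheses on the coefficients exclude spherical zeros because c and d are a_0 and a_1 plus
    real combinations of a_2, ..., a_n ([spherical_zero_real_coef]). In case (1) a real zero would
    moreover make a_0 real, so every zero is isolated. *)

(** * Real quadratics of classes and factorization of nonnegative real polynomials *)

Section ClassQuadratic.
Variable R : realType.
Implicit Types (p : R * R) (P Q : {poly R}).

Definition quad p : {poly R} := ('X - p.1%:P) ^+ 2 + (p.2 ^+ 2)%:P.

Lemma quadE p :
  quad p = 'X^2 - (2 * p.1) *: 'X + (p.1 ^+ 2 + p.2 ^+ 2)%:P.
Proof.
rewrite /quad -!mul_polyC !(rmorphD, rmorphM, rmorphXn, rmorph_nat) /=; ring.
Qed.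

Lemma horner_quad p x : (quad p).[x] = (x - p.1) ^+ 2 + p.2 ^+ 2.
Proof. by rewrite /quad !(hornerE, horner_exp). Qed.

Lemma size_quad p : size (quad p) = 3%N.
Proof.
rewrite /quad size_polyDl ?size_exp_XsubC //.
by rewrite (leq_ltn_trans (size_polyC_leq1 _)).
Qed.

Lemma monic_quad p : quad p \is monic.
Proof.
rewrite monicE /quad lead_coefDl ?lead_coef_exp ?lead_coefXsubC ?expr1n //.
by rewrite size_exp_XsubC (leq_ltn_trans (size_polyC_leq1 _)).
Qed.

Lemma quad_dvd_line p a b :
  quad p %| a%:P + b *: 'X -> a = 0 /\ b = 0.
Proof.
move=> dv; have E : a%:P + b *: 'X = 0 :> {poly R}.
  apply: contraTeq dv => nz; apply/negP => /(dvdp_leq nz).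
  rewrite size_quad leqNgt (leq_ltn_trans (size_polyD _ _)) // gtn_max.
  rewrite (leq_ltn_trans (size_polyC_leq1 _)) //=.
  by rewrite (leq_ltn_trans (size_scale_leq _ _)) // size_polyX.
split.
  by have := congr1 (fun P : {poly R} => P`_0) E; rewrite !coefE /= mulr0 addr0.
by have := congr1 (fun P : {poly R} => P`_1) E; rewrite !coefE /= mulr1 add0r.
Qed.

Lemma quad_dvd_quadratic p a b c :
  quad p %| a%:P + (2 * b) *: 'X + c *: 'X^2 <->
  a = (p.1 ^+ 2 + p.2 ^+ 2) * c /\ b = - p.1 * c.
Proof.
rewrite (_ : _ + c *: 'X^2 = c *: quad p + ((a - (p.1 ^+ 2 + p.2 ^+ 2) * c)%:P
   + (2 * (b + p.1 * c)) *: 'X)); last first.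
  rewrite quadE -!mul_polyC.
  by rewrite !(rmorphD, rmorphN, rmorphM, rmorphXn, rmorph_nat) /=; ring.
rewrite dvdp_addr; last by rewrite -mul_polyC dvdp_mull.
split=> [/quad_dvd_line[a0 b0]|[-> ->]]; first by split; lra.
rewrite subrr (_ : 2 * _ = 0); last by ring.
by rewrite scale0r addr0 dvdp0.
Qed.

(** The difference of the two quadratics is b + a X. If a = 0, it is a nonzero constant. Otherwise a
    common factor makes its root r a real root of [quad p'], so r = x' and y' = 0; then [quad p]
    vanishes at x' too, which forces x = x'. *)
Lemma coprime_quad p p' : 0 <= p.2 -> 0 <= p'.2 -> p != p' ->
  coprimep (quad p) (quad p').
Proof.
move: p p' => [x y] [x' y'] /= y0 y'0 ne.
set a := 2 * (x' - x); set b := x ^+ 2 + y ^+ 2 - (x' ^+ 2 + y' ^+ 2).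
have qE : quad (x, y) = 1 * quad (x', y') + (b%:P + a *: 'X).
  rewrite !quadE /= /a /b -!mul_polyC.
  by rewrite !(rmorphD, rmorphB, rmorphM, rmorphXn, rmorph_nat) /=; ring.
rewrite coprimep_sym qE coprimep_addl_mul.
have [xx|xx] := eqVneq x x'.
  have yy : b != 0.
    rewrite /b xx (_ : _ - _ = y ^+ 2 - y' ^+ 2); last by ring.
    rewrite subr_eq0 eqrXn2 //; apply: contraNneq ne => ->.
    by rewrite xx.
  by rewrite /a xx subrr mulr0 scale0r addr0 -alg_polyC coprimepZr ?coprimep1.
have a0 : a != 0 by rewrite mulf_eq0 pnatr_eq0 subr_eq0 (eq_sym x').
set r := - b / a.
have lE : b%:P + a *: 'X = a *: ('X - r%:P).
  rewrite scalerBr addrC -[a *: r%:P]mul_polyC -polyCM /r mulrC divfK //.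
  by rewrite polyCN opprK.
rewrite lE coprimepZr // coprimep_XsubC rootE horner_quad /=.
apply/negP; rewrite paddr_eq0 ?sqr_ge0 // !sqrf_eq0 => /andP[/eqP rx' /eqP y'E].
have : b + a * x' = 0 by rewrite -(subr0_eq rx') /r mulrC divfK // subrr.
rewrite /a /b y'E (_ : _ + _ = (x - x') ^+ 2 + y ^+ 2); last by ring.
by move/eqP; rewrite paddr_eq0 ?sqr_ge0 // !sqrf_eq0 subr_eq0 (negPf xx).
Qed.

Lemma poly_nonneg_continuity P x :
  (forall d, 0 < d -> exists2 y, `|y - x| < d & 0 <= P.[y]) -> 0 <= P.[x].
Proof.
move=> near; rewrite leNgt; apply/negP => Px.
have [|d d0 dP] := @poly_cont _ x P (- P.[x]); first by rewrite oppr_gt0.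
have [y /dP yx Py] := near _ d0; move: yx; rewrite ger0_norm; lra.
Qed.

(** The cofactor of X - x is nonpositive to the left of x and nonnegative to the right, so by
    continuity it vanishes at x. *)
Lemma nonneg_double_root P x : (forall y, 0 <= P.[y]) -> root P x ->
  ('X - x%:P) ^+ 2 %| P.
Proof.
move=> P0 /factor_theorem[Q PQ].
suff : root Q x by rewrite PQ expr2 dvdp_mul2r ?polyXsubC_eq0 // dvdp_XsubCl.
rewrite rootE eq_le; apply/andP; split.
  rewrite -oppr_ge0 -hornerN; apply: poly_nonneg_continuity => d d0.
  exists (x - d / 2); first by rewrite addrC addKr normrN ger0_norm; lra.
  have := P0 (x - d / 2); rewrite PQ !hornerE; nra.
apply: poly_nonneg_continuity => d d0.
exists (x + d / 2); first by rewrite addrC addKr ger0_norm; lra.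
have := P0 (x + d / 2); rewrite PQ !hornerE; nra.
Qed.

(** Away from [p.1] the quadratic is positive and can be divided out; continuity covers the point
    [p.1]. *)
Lemma nonneg_quad_quotient P p : (forall y, 0 <= (P * quad p).[y]) ->
  forall y, 0 <= P.[y].
Proof.
move=> Pp y; apply: poly_nonneg_continuity => d d0.
have [z zy q0] : exists2 z, `|z - y| < d & 0 < (quad p).[z].
  have [yp|yp] := eqVneq y p.1.
    exists (y + d / 2); first by rewrite addrC addKr ger0_norm; lra.
    rewrite horner_quad yp [p.1 + _]addrC addrK.
    by rewrite ltr_wpDr ?sqr_ge0 // exprn_gt0 //; lra.
  exists y; first by rewrite subrr normr0.
  by rewrite horner_quad ltr_wpDr ?sqr_ge0 // exprn_even_gt0 //= subr_eq0.
by exists z => //; have := Pp z; rewrite hornerM pmulr_lge0.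
Qed.

(** Take a complex root x + iy. If y = 0, it is a double root by nonnegativity. Otherwise the
    remainder modulo the quadratic is a real polynomial of degree at most 1 with a non-real root,
    hence zero. *)
Lemma quad_dvd_nonneg P : (forall y, 0 <= P.[y]) -> (1 < size P)%N ->
  exists2 p, 0 <= p.2 & quad p %| P.
Proof.
move=> P0 sP.
have [|[x y] zP] := @closed_rootP _ (map_poly (real_complex R) P) _.
  by rewrite size_map_poly gtn_eqF.
exists (x, `|y|) => //=.
have [y0|y0] := eqVneq y 0.
  rewrite /quad /= y0 normr0 expr0n addr0; apply: nonneg_double_root => //.
  by move: zP; rewrite y0 -(fmorph_root (real_complex R)).
set q := quad (x, `|y|); set z := (x +i* y)%C in zP.
have qz : (map_poly (real_complex R) q).[z] = 0.
  rewrite /q /quad /= real_normK ?num_real //.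
  rewrite !(rmorphD, rmorphN, rmorphXn) /= map_polyX !map_polyC /=.
  rewrite !(hornerE, horner_exp) /=.
  apply/eqP; rewrite eq_complex /=; apply/andP; split; apply/eqP; ring.
have rz : (map_poly (real_complex R) (P %% q)).[z] = 0.
  move: zP; rewrite rootE {1}(divp_eq P q) rmorphD rmorphM /= !hornerE qz.
  rewrite mulr0 add0r.
  by move/eqP.
have rE : P %% q = ((P %% q)`_0)%:P + ((P %% q)`_1) *: 'X.
  apply/polyP => -[|[|i]]; rewrite !coefE /= ?mulr0 ?mulr1 ?addr0 ?add0r //.
  have : (size (P %% q)%R < 3)%N.
    by rewrite -(size_quad (x, `|y|)) ltn_modp -size_poly_gt0 size_quad.
  by move=> sr; apply: nth_default; rewrite -ltnS (leq_trans sr).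
move: rE rz; move: (P %% q)`_0 (P %% q)`_1 => a b rE; rewrite rE.
rewrite -mul_polyC rmorphD rmorphM /= map_polyX !map_polyC /= !hornerE /=.
move/eqP; rewrite eq_complex /= => /andP[/eqP r1 /eqP r2].
have b0 : b = 0 by apply: (mulIf y0); rewrite mul0r; lra.
have a0 : a = 0 by move: r1; rewrite b0; lra.
by rewrite /dvdp rE a0 b0 scale0r addr0 polyC0.
Qed.

Lemma nonneg_factor n P : (forall y, 0 <= P.[y]) -> size P = (2 * n)%N.+1 ->
  exists s : seq (R * R), [/\ size s = n, forall p, p \in s -> 0 <= p.2 &
    P = lead_coef P *: \prod_(p <- s) quad p].
Proof.
elim: n P => [|n IHn] P P0 sP.
  exists [::]; split=> //; rewrite big_nil alg_polyC.
  by rewrite {1}(size1_polyC (eq_leq sP)) lead_coefE sP.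
have [|p p0 /dvdpP[Q PQ]] := quad_dvd_nonneg P0; first by rewrite sP.
have Q0 : forall y, 0 <= Q.[y].
  by apply: (@nonneg_quad_quotient _ p); rewrite -PQ.
have Qn0 : Q != 0.
  by apply/eqP => Q00; move: sP; rewrite PQ Q00 mul0r size_poly0.
have sQ : size Q = (2 * n)%N.+1.
  move: sP; rewrite PQ size_Mmonic ?monic_quad // size_quad.
  by move: (size Q) => m; lia.
have [s [sn s0 QE]] := IHn Q Q0 sQ.
exists (p :: s); split=> /=; first by rewrite sn.
  by move=> q; rewrite inE => /predU1P[-> //|/s0].
by rewrite big_cons PQ lead_coef_Mmonic ?monic_quad // mulrC scalerAr -QE.
Qed.

Lemma dvd_quad_exp (s : seq (R * R)) p k : 0 <= p.2 ->
  (forall q, q \in s -> 0 <= q.2) ->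
  (quad p ^+ k %| \prod_(q <- s) quad q) = (k <= count_mem p s)%N.
Proof.
move=> p0; elim: s k => [|q s IHs] k s0.
  rewrite big_nil dvdp1; case: k => [|k]; first by rewrite expr0 size_poly1.
  by apply/negP => /eqP E; have := size_exp (quad p) k.+1; rewrite E size_quad.
have {}IHs k' : _ := IHs k' (fun q qs => s0 q (@mem_behead _ (_ :: _) q qs)).
rewrite big_cons /=; have [->|ne] := eqVneq q p.
  case: k => [|k]; first by rewrite expr0 dvd1p.
  by rewrite exprS dvdp_mul2l ?IHs // monic_neq0 ?monic_quad.
rewrite Gauss_dvdpr ?IHs //; apply: coprimep_expl; apply: coprime_quad => //.
  by apply: s0; rewrite mem_head.
by rewrite eq_sym.
Qed.

End ClassQuadratic.

(** * The inner product of octonions, conjugacy classes, and powers on a class *)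

Section OctonionInner.
Variable R : realType.
Implicit Types (x y z w : octonion R) (r : R) (p : R * R).

(* Locked: unification must not unfold it down to real coordinates. *)
Fact odot_key : unit. Proof. by []. Qed.

Definition odot x y : R := locked_with odot_key (oRe (x ** oconj y)).

Lemma odotE x y : odot x y = oRe (x ** oconj y).
Proof. by rewrite /odot unlock. Qed.

Lemma odotC x y : odot x y = odot y x.
Proof. by rewrite !odotE /oRe /=; ring. Qed.

Lemma odot0 : odot 0 0 = 0.
Proof. by rewrite !odotE /oRe /=; ring. Qed.

Lemma odot_scalel r x y : odot (oreal r ** x) y = r * odot x y.
Proof. by rewrite !odotE /oRe /=; ring. Qed.

Lemma odot_scaler r x y : odot x (oreal r ** y) = r * odot x y.
Proof. by rewrite odotC odot_scalel odotC. Qed.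

Lemma odot_sumr (I : Type) (s : seq I) (P : pred I) (F : I -> octonion R) x :
  odot x (\sum_(i <- s | P i) F i) = \sum_(i <- s | P i) odot x (F i).
Proof.
apply: (big_morph (odot x)) => [y z|]; last by rewrite !odotE /oRe /=; ring.
by rewrite !odotE /oRe /=; ring.
Qed.

Lemma odot_suml (I : Type) (s : seq I) (P : pred I) (F : I -> octonion R) x :
  odot (\sum_(i <- s | P i) F i) x = \sum_(i <- s | P i) odot (F i) x.
Proof. by rewrite odotC odot_sumr; apply: eq_bigr => i _; rewrite odotC. Qed.

Lemma odot_oreal r : odot (oreal r) (oreal r) = r ^+ 2.
Proof. by rewrite !odotE /oRe /=; ring. Qed.

Lemma odot_conj x : odot (oconj x) (oconj x) = odot x x.
Proof. by rewrite !odotE /oRe /=; ring. Qed.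

Lemma oRe_scale r x : oRe (oreal r ** x) = r * oRe x.
Proof. by rewrite /oRe /=; ring. Qed.

Lemma omul_scale r s x : oreal r ** (oreal s ** x) = oreal (r * s) ** x.
Proof. octonion_ring. Qed.

Lemma omul_scalel r x y : (oreal r ** x) ** y = oreal r ** (x ** y).
Proof. octonion_ring. Qed.

Lemma omulA_scale r x y : (x ** oreal r) ** y = x ** (oreal r ** y).
Proof. octonion_ring. Qed.

Lemma omul_conjK x y : (x ** oconj y) ** y = oreal (odot y y) ** x.
Proof. rewrite !odotE; octonion_ring. Qed.

Lemma odot_ge0 x : 0 <= odot x x.
Proof. by rewrite odotE oRe_mul_conj_ge0. Qed.

Lemma odot_eq0 x : odot x x = 0 -> x = 0.
Proof.
by rewrite !odotE -onorm_sqr => /eqP; rewrite sqrf_eq0 => /eqP/onorm_eq0.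
Qed.

Lemma odotM x y : odot (x ** y) (x ** y) = odot x x * odot y y.
Proof. by rewrite !odotE -!onorm_sqr onormM exprMn. Qed.

Lemma odot_mull w x : odot (w ** x) x = oRe w * odot x x.
Proof. by rewrite !odotE /oRe /=; ring. Qed.

Lemma omul_eq0 x y : x ** y = 0 -> x = 0 \/ y = 0.
Proof.
move=> xy0; have := odotM x y; rewrite xy0 odot0 => /esym/eqP.
by rewrite mulf_eq0 => /orP[]/eqP/odot_eq0; [left|right].
Qed.

Definition oclass w : R * R := (oRe w, onorm (oIm w)).

Lemma oclass_ge0 w : 0 <= (oclass w).2.
Proof. exact: sqrtr_ge0. Qed.

Lemma odot_oIm w : odot (oIm w) (oIm w) = odot w w - oRe w ^+ 2.
Proof. by rewrite /oIm !odotE /oRe /=; ring. Qed.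

Lemma Delta_quad w : Delta w = quad (oclass w).
Proof.
rewrite quadE /Delta /= !onorm_sqr -!odotE odot_oIm.
by rewrite [oRe w ^+ 2 + _]addrC addrNK.
Qed.

Lemma oclassP w p : 0 <= p.2 -> oRe w = p.1 ->
  odot w w = p.1 ^+ 2 + p.2 ^+ 2 -> oclass w = p.
Proof.
case: p => a b /= b0 wa ww; rewrite /oclass wa; congr pair.
rewrite /onorm -!odotE odot_oIm wa ww addrC addKr.
by rewrite sqrtr_sqr ger0_norm.
Qed.

Lemma oclass_norm w p : oclass w = p -> odot w w = p.1 ^+ 2 + p.2 ^+ 2.
Proof.
by move=> <- /=; rewrite onorm_sqr -!odotE odot_oIm [RHS]addrC addrNK.
Qed.

Lemma oclass_is_real w : is_real w <-> (oclass w).2 = 0.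
Proof.
split=> [[r ->]|/onorm_eq0 w0]; last first.
  by exists (oRe w); apply/eqP; rewrite -subr_eq0 -/(oIm w) w0.
rewrite /= /onorm -!odotE odot_oIm !odotE /oRe /=.
by rewrite (_ : _ - _ = 0) ?sqrtr0 //; ring.
Qed.

(** Multiplicativity of the norm gives |I| = 1; then Re(I^2) = 2 Re(I)^2 - |I|^2 = -1 gives Re(I) =
    0. *)
Lemma odot_imag_unit (I : octonion R) :
  I ** I = - oreal 1 -> oRe I = 0 /\ odot I I = 1.
Proof.
move=> II; have n1 : odot I I = 1.
  have : odot I I ^+ 2 = 1 by rewrite expr2 -odotM II !odotE /oRe /=; ring.
  by move/eqP; rewrite sqrf_eq1 => /orP[/eqP//|/eqP E]; have := odot_ge0 I; lra.
split=> //; apply/eqP; rewrite -sqrf_eq0; apply/eqP.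
have : oRe (I ** I) = 2 * oRe I ^+ 2 - odot I I by rewrite !odotE /oRe /=; ring.
rewrite II n1 (_ : oRe _ = -1); last by rewrite /oRe /=; ring.
by lra.
Qed.

Lemma oclass_plane p (I : octonion R) : 0 <= p.2 -> I ** I = - oreal 1 ->
  oclass (oreal p.1 + oreal p.2 ** I) = p.
Proof.
case: p => a b /= b0 /odot_imag_unit[I0 I1]; apply: oclassP => //=.
  have -> : oRe (oreal a + oreal b ** I) = a + b * oRe I.
    by rewrite /oRe /=; ring.
  by rewrite I0; ring.
have -> : odot (oreal a + oreal b ** I) (oreal a + oreal b ** I)
        = a ^+ 2 + 2 * a * b * oRe I + b ^+ 2 * odot I I.
  by rewrite !odotE /oRe /=; ring.
by rewrite I0 I1; ring.
Qed.

Definition ounit : octonion R := (((0, 1), (0, 0)), ((0, 0), (0, 0))).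

Lemma ounit_sqr : ounit ** ounit = - oreal 1.
Proof. octonion_ring. Qed.

(* On the class of [p] every power [w^k] is [A_k + w B_k] with the same real  *)
(* [A_k], [B_k] as for the residue of ['X^k] modulo [quad p].                 *)
Fixpoint class_pow p k : R * R :=
  if k is k'.+1 then
    let ab := class_pow p k' in
    (- (p.1 ^+ 2 + p.2 ^+ 2) * ab.2, ab.1 + 2 * p.1 * ab.2)
  else (1, 0).

(** The recursion of [class_pow] is multiplication by w followed by the reduction w^2 = 2 Re(w) w -
    |w|^2. *)
Lemma opow_class w k : let ab := class_pow (oclass w) k in
  opow w k = oreal ab.1 + w ** oreal ab.2.
Proof.
elim: k => [|k IHk]; first by rewrite /=; octonion_ring.
rewrite /opow iterS -/(opow _ _) IHk /=.
rewrite -[_ + onorm _ ^+ 2](oclass_norm (erefl (oclass w))).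
move: (class_pow _ _).1 (class_pow _ _).2 => a b.
rewrite !odotE; octonion_ring.
Qed.

Lemma Xn_class p k : let ab := class_pow p k in
  quad p %| 'X^k - (ab.1%:P + ab.2 *: 'X).
Proof.
elim: k => [|k IHk] /=; first by rewrite expr0 scale0r addr0 subrr dvdp0.
move: IHk => /=; move: (class_pow _ _).1 (class_pow _ _).2 => a b IHk.
have -> : 'X^(k.+1) - ((- (p.1 ^+ 2 + p.2 ^+ 2) * b)%:P
                       + (a + 2 * p.1 * b) *: 'X)
        = 'X * ('X^k - (a%:P + b *: 'X)) + b%:P * quad p :> {poly R}.
  rewrite quadE -!mul_polyC exprS.
  by rewrite !(rmorphD, rmorphN, rmorphM, rmorphXn, rmorph_nat) /=; ring.
by rewrite dvdp_add ?dvdp_mull.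
Qed.

End OctonionInner.

(** * An octonionic polynomial on one class, and its norm polynomial *)

Section OctpolyOnClass.
Variables (R : realType) (f : octpoly R).
Implicit Types (w : octonion R) (p : R * R).

Definition class_const p : octonion R :=
  \sum_(i < size f) oreal (class_pow p i).1 ** f`_i.

Definition class_slope p : octonion R :=
  \sum_(i < size f) oreal (class_pow p i).2 ** f`_i.

Lemma omul_sumr (I : Type) (s : seq I) (P : pred I) (F : I -> octonion R) w :
  w ** (\sum_(i <- s | P i) F i) = \sum_(i <- s | P i) w ** F i.
Proof.
apply: (big_morph (omul w)) => [y z|]; first exact: omulDr.
octonion_ring.
Qed.

Lemma oeval_class w :
  oeval f w = class_const (oclass w) + w ** class_slope (oclass w).
Proof.
rewrite /oeval /class_const /class_slope omul_sumr -big_split /=.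
by apply: eq_bigr => i _; rewrite opow_class omulDl omulA_scale.
Qed.

Lemma oRe_sum (I : Type) (s : seq I) (P : pred I) (F : I -> octonion R) :
  oRe (\sum_(i <- s | P i) F i) = \sum_(i <- s | P i) oRe (F i).
Proof. exact: (big_morph (@oRe R)). Qed.

(** Written as a Gram form in the coefficients, N(f) can be reduced modulo [quad p] power by power,
    and its values at real points become squared norms. *)
Lemma normpoly_odot : normpoly f =
  \sum_(i < size f) \sum_(j < size f) odot f`_i f`_j *: 'X^(i + j).
Proof.
apply/polyP => k; rewrite coef_sum.
under eq_bigr => i _ do rewrite coef_sum.
under eq_bigr => i _ do under eq_bigr => j _ do rewrite coefZ coefXn.
rewrite /normpoly coef_poly; case: ltnP => [kf|kf].
  rewrite nth_Nstar // oRe_sum; apply: eq_bigr => i _.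
  rewrite oRe_sum big_mkcond; apply: eq_bigr => j _.
  by rewrite eq_sym odotE; case: eqP; rewrite ?mulr1 ?mulr0.
rewrite big1 // => i _; rewrite big1 // => j _.
rewrite gtn_eqF ?mulr0 //; apply: leq_trans kf; rewrite size_Nstar.
have := ltn_ord i; have := ltn_ord j; move: (size f) (i : nat) (j : nat); lia.
Qed.

Lemma normpoly_class p (c := class_const p) (d := class_slope p) :
  quad p %| normpoly f -
    ((odot c c)%:P + (2 * odot c d) *: 'X + odot d d *: 'X^2).
Proof.
set L := fun i => (class_pow p i).1%:P + (class_pow p i).2 *: 'X : {poly R}.
have -> : (odot c c)%:P + (2 * odot c d) *: 'X + odot d d *: 'X^2 =
    \sum_(i < size f) \sum_(j < size f) odot f`_i f`_j *: (L i * L j).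
  have sumE (F G : nat -> R) : odot (\sum_(i < size f) oreal (F i) ** f`_i)
      (\sum_(j < size f) oreal (G j) ** f`_j) =
      \sum_(i < size f) \sum_(j < size f) F i * G j * odot f`_i f`_j.
    rewrite odot_suml; apply: eq_bigr => i _; rewrite odot_sumr.
    apply: eq_bigr => j _; rewrite odot_scalel odot_scaler; ring.
  pose A i := (class_pow p i).1; pose B i := (class_pow p i).2.
  have -> : 2 * odot c d = odot c d + odot d c.
    by rewrite [odot d c]odotC mulr_natl mulr2n.
  rewrite (sumE A A : odot c c = _) (sumE A B : odot c d = _).
  rewrite (sumE B A : odot d c = _) (sumE B B : odot d d = _).
  rewrite -!mul_polyC rmorphD /= !rmorph_sum /= mulrDl !mulr_suml.
  rewrite -!big_split; apply: eq_bigr => i _ /=.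
  rewrite !rmorph_sum /= !mulr_suml -!big_split; apply: eq_bigr => j _ /=.
  by rewrite /L /A /B -!mul_polyC !rmorphM /=; ring.
rewrite normpoly_odot -sumrB.
apply: (big_ind (fun P => quad p %| P)); [exact: dvdp0 | exact: dvdp_add |].
move=> i _; rewrite -sumrB.
apply: (big_ind (fun P => quad p %| P)); [exact: dvdp0 | exact: dvdp_add |].
move=> j _; rewrite -scalerBr -mul_polyC dvdp_mull //.
rewrite exprD.
(* [L i] is the residue of X^i modulo [quad p]; the factors are replaced one at a time. *)
rewrite (_ : _ - _ = 'X^i * ('X^j - L j) + L j * ('X^i - L i)); last by ring.
by apply: dvdp_add; apply: dvdp_mull; apply: Xn_class.
Qed.

Lemma quad_dvd_normpoly p (c := class_const p) (d := class_slope p) :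
  quad p %| normpoly f <->
  odot c c = (p.1 ^+ 2 + p.2 ^+ 2) * odot d d /\ odot c d = - p.1 * odot d d.
Proof.
have /dvdp_addr dvdE := normpoly_class p.
have := quad_dvd_quadratic p (odot c c) (odot c d) (odot d d).
by rewrite -dvdE subrK.
Qed.

(** With c = - w d, one has |c|^2 = |w|^2 |d|^2 and <c,d> = - Re(w) |d|^2, the two divisibility
    conditions. *)
Lemma zero_quad_dvd w : oeval f w = 0 -> quad (oclass w) %| normpoly f.
Proof.
rewrite oeval_class => /eqP; rewrite addr_eq0 => /eqP fw.
apply/quad_dvd_normpoly; rewrite fw.
have -> (x : octonion R) : - x = oreal (-1) ** x by octonion_ring.
rewrite !(odot_scalel, odot_scaler) odotM.
rewrite (oclass_norm (erefl (oclass w))) odot_mull /=.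
by split; ring.
Qed.

Lemma quad_dvd_zero p : 0 <= p.2 -> quad p %| normpoly f ->
  exists2 w, oclass w = p & oeval f w = 0.
Proof.
move=> p0 /quad_dvd_normpoly.
have [d0|d0] := eqVneq (class_slope p) 0.
  rewrite d0 odot0 mulr0 => -[/odot_eq0 c0 _].
  (* Here c = d = 0, so any point of the class is a zero. *)
  exists (oreal p.1 + oreal p.2 ** ounit R).
    by apply: oclass_plane p0 (ounit_sqr R).
  by rewrite oeval_class oclass_plane ?ounit_sqr // c0 d0; octonion_ring.
have oevalE w : oclass w = p -> oeval f w = class_const p + w ** class_slope p.
  by move=> <-; apply: oeval_class.
move: (class_const p) (class_slope p) d0 oevalE => c d d0 oevalE [cc cd].
have nd : odot d d != 0 by apply: contra_neq d0 => /odot_eq0.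
(* The only solution of c + w d = 0 is w = - c d^-1; the divisibility conditions say that its real
   part and norm are those of the class. *)
set w := oreal (- (odot d d)^-1) ** (c ** oconj d).
have wp : oclass w = p.
  apply: oclassP => //.
    by rewrite oRe_scale -odotE cd; field.
  by rewrite /w !odotM odot_oreal odot_conj cc; field.
exists w => //; rewrite oevalE //.
rewrite omul_scalel omul_conjK omul_scale mulNr mulVf //; octonion_ring.
Qed.

Lemma normpoly_ge0 (x : R) : 0 <= (normpoly f).[x].
Proof.
suff -> : (normpoly f).[x] =
    odot (\sum_(i < size f) oreal (x ^+ i) ** f`_i)
         (\sum_(j < size f) oreal (x ^+ j) ** f`_j) by apply: odot_ge0.
rewrite normpoly_odot horner_sum odot_suml; apply: eq_bigr => i _.
rewrite horner_sum odot_sumr; apply: eq_bigr => j _.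
rewrite odot_scalel odot_scaler hornerZ hornerXn exprD; ring.
Qed.

Lemma size_normpoly n : size f = n.+1 -> f`_n != 0 ->
  size (normpoly f) = (2 * n)%N.+1.
Proof.
move=> fn fn0; apply/eqP; rewrite eqn_leq; apply/andP; split.
  rewrite (leq_trans (size_poly _ _)) // size_Nstar fn; lia.
rewrite ltnNge; apply/negP => /leq_sizeP/(_ _ (leqnn _)).
rewrite normpoly_odot fn coef_sum big_ord_recr /= big1 ?add0r => [|i _].
  rewrite coef_sum big_ord_recr /= big1 ?add0r => [|i _].
    rewrite coefZ coefXn mul2n addnn eqxx mulr1 => /odot_eq0/eqP.
    by rewrite (negPf fn0).
  rewrite coefZ coefXn gtn_eqF ?mulr0 //; have := ltn_ord i; lia.
rewrite coef_sum big1 // => j _; rewrite coefZ coefXn gtn_eqF ?mulr0 //.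
by have := ltn_ord i; have := ltn_ord j; rewrite /=; lia.
Qed.

(** Subtracting the two equations gives (w - w') d = 0, and there are no zero divisors. *)
Lemma class_slope_eq0 w w' : oeval f w = 0 -> oeval f w' = 0 ->
  oclass w = oclass w' -> w != w' ->
  class_const (oclass w) = 0 /\ class_slope (oclass w) = 0.
Proof.
rewrite !oeval_class => fw fw' ww' ne; rewrite -ww' in fw'.
have : (w - w') ** class_slope (oclass w) = 0.
  apply: (etrans _ (subrr (0 : octonion R))); rewrite -{1}fw -fw'.
  by move: (class_const _) (class_slope _) {fw fw'} => c d; octonion_ring.
case/omul_eq0 => [/eqP|d0]; first by rewrite subr_eq0 (negPf ne).
split=> //; move: fw; rewrite d0 => <-.
by move: (class_const _) => c; octonion_ring.
Qed.

Lemma two_zeros_spherical w w' : oeval f w = 0 -> oeval f w' = 0 ->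
  oclass w = oclass w' -> w != w' -> spherical_zero f w.
Proof.
move=> fw fw' ww' ne; have [c0 d0] := class_slope_eq0 fw fw' ww' ne.
split.
  move=> rw; have rw' : is_real w'.
    by apply/oclass_is_real; rewrite -ww'; apply/oclass_is_real.
  case: rw rw' ww' ne => [r ->] [r' ->] [] /=; rewrite /oRe /= => ->.
  by rewrite eqxx.
move=> x [I [II ->]]; rewrite /V /=.
have xw := oclass_plane (oclass_ge0 w) II.
by rewrite oeval_class xw c0 d0; octonion_ring.
Qed.

Lemma spherical_class_slope alpha : spherical_zero f alpha ->
  class_const (oclass alpha) = 0 /\ class_slope (oclass alpha) = 0.
Proof.
case=> nreal sph; set p := oclass alpha; pose u := ounit R.
have uu : - u ** - u = - oreal 1 by rewrite /u; octonion_ring.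
have p0 : 0 <= p.2 := oclass_ge0 alpha.
rewrite -(oclass_plane p0 (ounit_sqr R)).
apply: (@class_slope_eq0 _ (oreal p.1 + oreal p.2 ** - u)).
- by apply: sph; exists u; split=> //; exact: ounit_sqr.
- by apply: sph; exists (- u).
- by rewrite !oclass_plane ?ounit_sqr.
(* The two points differ by the sign of [p.2] in this coordinate; if they were equal, [p.2] would be
   0 and [alpha] real. *)
apply/eqP => /(congr1 (fun x : octonion R => x.1.1.2)) /= E.
by apply/nreal/oclass_is_real => /=; lra.
Qed.

End OctpolyOnClass.

Lemma sum_count_mem (T : eqType) (s : seq T) :
  (\sum_(x <- undup s) count_mem x s = size s)%N.
Proof.
rewrite -sum1_size -[RHS]big_undup_iterop_count; apply: eq_bigr => x _.
by rewrite Monoid.iteropE iter_addn_0 mul1n.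
Qed.

(** * Consequences of real coefficients *)

Section RealCoefficients.
Variable R : realType.
Implicit Types (x y : octonion R) (f : octpoly R).

Lemma is_realM x y : is_real x -> is_real y -> is_real (x ** y).
Proof. by move=> [r ->] [r' ->]; exists (r * r'); octonion_ring. Qed.

Lemma is_real_opow x k : is_real x -> is_real (opow x k).
Proof.
by move=> rx; elim: k => [|k IHk]; [exists 1 | apply: is_realM].
Qed.

Lemma is_real_sum (I : finType) (F : I -> octonion R) :
  (forall i, is_real (F i)) -> is_real (\sum_i F i).
Proof.
move=> rF; apply: (big_ind (@is_real R)) => [|x y [r ->] [r' ->]|//].
  by exists 0.
by exists (r + r'); apply: octonion_eq; rewrite /= ?addr0.
Qed.

Lemma is_real_summand x y : is_real y -> x + y = 0 -> is_real x.
Proof.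
case=> r -> /eqP; rewrite addr_eq0 => /eqP ->; exists (- r).
by apply: octonion_eq; rewrite /= ?oppr0.
Qed.

Lemma real_zero_real_const n f alpha : size f = n.+1 ->
  (forall i : nat, (1 <= i <= n)%N -> is_real f`_i) ->
  is_real alpha -> oeval f alpha = 0 -> is_real f`_0.
Proof.
move=> fn fi ra; rewrite /oeval fn big_ord_recl /= mul1o.
apply: is_real_summand; apply: is_real_sum => i.
apply: is_realM; first exact: (is_real_opow i.+1 ra).
by apply: fi; rewrite /= ltn_ord.
Qed.

(** Since [class_pow] is (1, 0) at 0 and (0, 1) at 1, the equations c = 0 and d = 0 read a_0 + real
    = 0 and a_1 + real = 0. *)
Lemma spherical_zero_real_coef n f alpha : spherical_zero f alpha ->
  size f = n.+2 -> (forall i : nat, (2 <= i <= n.+1)%N -> is_real f`_i) ->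
  is_real f`_0 /\ is_real f`_1.
Proof.
move=> /spherical_class_slope[c0 d0] fn fi.
have real_tail (F : nat -> R) :
    is_real (\sum_(i < n) oreal (F i) ** f`_(bump 0 (bump 0 i))).
  apply: is_real_sum => i; apply: is_realM; first by exists (F i).
  by apply: fi; rewrite /= ltnS ltn_ord.
move: c0 d0; rewrite /class_const /class_slope fn !big_ord_recl /=.
set q := oclass alpha => c0 d0; split.
  apply: is_real_summand (real_tail (fun i => (class_pow q i.+2).1)) _.
  by rewrite -[RHS]c0 /=; move: (\sum_(i < n) _) => x; octonion_ring.
apply: is_real_summand (real_tail (fun i => (class_pow q i.+2).2)) _.
by rewrite -[RHS]d0 /=; move: (\sum_(i < n) _) => x; octonion_ring.
Qed.

End RealCoefficients.

(** * Counting zeros, and the theorem *)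

Lemma no_spherical_zeros_count (R : realType) (n : nat) (f : octpoly R) :
  size f = n.+1 -> f`_n != 0 -> (forall alpha, ~ spherical_zero f alpha) ->
  has_exactly_zeros_with_mult f n.
Proof.
move=> size_f lead_f nosph.
have [s [sn s0 PE]] :=
  nonneg_factor (normpoly_ge0 f) (size_normpoly size_f lead_f).
have lead0 : lead_coef (normpoly f) != 0.
  by rewrite lead_coef_eq0 (normpoly_neq0 size_f).
have dvdE p k : 0 <= p.2 ->
    (quad p ^+ k %| normpoly f) = (k <= count_mem p s)%N.
  by move=> p0; rewrite PE dvdpZr // dvd_quad_exp.
have multE w : multiplicity f w = count_mem (oclass w) s.
  apply: multiplicity_uniq; rewrite Delta_quad dvdE ?oclass_ge0 //.
  by rewrite ltnn.
have memE p : 0 <= p.2 -> (p \in s) = (quad p %| normpoly f).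
  by move=> p0; rewrite -[quad p]expr1 dvdE // -has_pred1 has_count.
(* [z] picks a zero in each class of [s], with the junk value 0 elsewhere. It is onto V(f) because
   no class holds two zeros, and injective on [s] because [oclass] inverts it. *)
have /choice[z zP] : forall p, exists w,
    p \in s -> oclass w = p /\ oeval f w = 0.
  move=> p.
  have [ps|] := boolP (p \in s); last by exists 0.
  have [|w wp fw] := @quad_dvd_zero _ f p (s0 _ ps); first by rewrite -memE ?s0.
  by exists w.
have VE : V f = [set` [seq z p | p <- undup s]].
  apply/seteqP; split=> w /=.
    move=> fw; apply/mapP; exists (oclass w).
      by rewrite mem_undup memE ?oclass_ge0 // zero_quad_dvd.
    have ws : oclass w \in s by rewrite memE ?oclass_ge0 // zero_quad_dvd.
    have [zw fz] := zP _ ws.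
    apply/eqP/negPn/negP => ne; apply: (nosph w).
    by apply: two_zeros_spherical fw fz _ ne; rewrite zw.
  by case/mapP=> p; rewrite mem_undup => /zP[_ fz] ->.
split; first by rewrite VE; apply: finite_seq.
rewrite VE -fsbig_seq.
  rewrite big_map -sn -sum_count_mem; apply: eq_big_seq => p.
  by rewrite mem_undup => /zP[zp _]; rewrite multE zp.
rewrite map_inj_in_uniq ?undup_uniq // => p q.
rewrite !mem_undup => /zP[zp _] /zP[zq _].
by rewrite -{2}zp -{2}zq => ->.
Qed.

Theorem corollary13 (R : realType) (n : nat) (f : octpoly R)
    (n_gt0 : (0 < n)%N) (size_f : size f = n.+1) (lead_f : f`_n != 0) :
  ((forall i : nat, (1 <= i <= n)%N -> is_real f`_i) -> ~ is_real f`_0 ->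
     (forall alpha, V f alpha -> isolated_zero f alpha) /\
     has_exactly_zeros_with_mult f n)
  /\
  ((forall i : nat, (2 <= i <= n)%N -> is_real f`_i) ->
     ~ is_real f`_0 \/ ~ is_real f`_1 ->
     (forall alpha, ~ spherical_zero f alpha) /\
     has_exactly_zeros_with_mult f n).
Proof.
have nosph : (forall i : nat, (2 <= i <= n)%N -> is_real f`_i) ->
    ~ is_real f`_0 \/ ~ is_real f`_1 -> forall alpha, ~ spherical_zero f alpha.
  (* Positive degree ensures that the coefficient a_1 is present. *)
  case: n n_gt0 size_f {lead_f} => // m _ fm fi f01 alpha sph.
  by have [] := spherical_zero_real_coef sph fm fi; case: f01.
split=> [fi f0|fi f01]; last first.
  split; first exact: nosph.
  by apply: no_spherical_zeros_count => //; exact: nosph.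
(* The hypotheses of (1) imply those of (2), so only real zeros remain to be excluded. *)
have nosph0 alpha : ~ spherical_zero f alpha.
  by apply: nosph; [move=> i /andP[i2 iN]; apply: fi; rewrite (ltnW i2) | left].
split; last exact: no_spherical_zeros_count.
move=> alpha fa; have nra : ~ is_real alpha.
  by move=> ra; apply: f0; apply: real_zero_real_const size_f fi ra fa.
by split=> // sph; apply: (nosph0 alpha).
Qed.
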